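(* In the setting of the context, assume that $n>1$. Then for every $i=1,\dots,r$ there exists $c_i>0$, independent of $t$, such that $\mathrm{bdry}\,C_i(t)$ is $c_i$-quasiconvex for every $t\in[0,T]$, in the following precise sense: for every $t\in[0,T]$ and every $x,y\in\mathrm{bdry}\,C_i(t)$ there exists a $\mathcal C^1$ curve $\Gamma:[0,1]\to\mathrm{bdry}\,C_i(t)$ such that $$\Gamma(0)=x,\qquad \Gamma(1)=y,\qquad \ell(\Gamma):=\int_0^1\|\dot\Gamma(s)\|\,ds\le c_i\|y-x\|.$$
   Context: Fix $T>0$ and $n,r\in\mathbb N$ (positive), functions $\psi_i:[0,T]\times\mathbb R^n\to\mathbb R$ ($i=1,\dots,r$), and put $C_i(t):=\{x\in\mathbb R^n:\psi_i(t,x)\le0\}$, $C(t):=\bigcap_{i=1}^rC_i(t)$. $\|\cdot\|$ is the Euclidean norm and $B(0;\rho)$ the open ball of radius $\rho$ centered at $0$. Standing hypothesis (H3): $C(t)\ne\emptyset$ for all $t\in[0,T]$; each $\psi_i$ is continuous on $[0,T]\times\mathbb R^n$, and $\psi_i(t,\cdot)$ is $\mathcal C^{1,1}$ (differentiable with locally Lipschitz derivative) for each $t$. For every $i$ and $t$, $\mathrm{bdry}\,C_i(t)$ is connected if $n>1$, and $C_i(t)$ is convex if $n=1$. There are $M_t,M_\psi,R>0$ such that for all $i$ and all $t$, $C_i(t)\subset B(0;R)$, and for all $t,s\in[0,T]$, $x,y\in B(0;2R)$: $|\psi_i(t,x)-\psi_i(s,x)|\le M_t|t-s|$ and $\|\nabla_x\psi_i(t,x)-\nabla_x\psi_i(t,y)\|\le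 2M_\psi\|x-y\|$. With $\mathcal I^0_x(t):=\{i:\psi_i(t,x)=0\}$, there is $\eta>0$ such that for every $t\in[0,T]$, every $c\in\mathbb R^n$ with $\mathcal I^0_c(t)\neq\emptyset$, and all $\lambda_i\ge0$ ($i\in\mathcal I^0_c(t)$) with $\sum_i\lambda_i=1$: $\big\|\sum_{i\in\mathcal I^0_c(t)}\lambda_i\nabla_x\psi_i(t,c)\big\|>2\eta$. *)

(* Defs.v *)
From HB Require Import structures.
From mathcomp Require Import all_boot all_order all_algebra.
From mathcomp Require Import all_classical all_reals all_analysis.
Set Implicit Arguments.
Unset Strict Implicit.
Unset Printing Implicit Defensive.
Import Order.TTheory GRing.Theory Num.Theory.
Import numFieldNormedType.Exports.
Local Open Scope classical_set_scope.
Local Open Scope ring_scope.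

(* The library norm `|x| on 'rV[R]_n is the sup norm, so the Euclidean norm is
   defined here; both induce the library topology of 'rV[R]_n. *)
Definition enorm (R : realType) (n : nat) (x : 'rV[R]_n) : R :=
  Num.sqrt (\sum_j x 0 j ^+ 2).

Definition eball (R : realType) (n : nat) (rho : R) : set 'rV[R]_n :=
  [set x | enorm x < rho].

Definition bdry (R : realType) (n : nat) (A : set 'rV[R]_n) : set 'rV[R]_n :=
  closure A `\` interior A.

Definition grad (R : realType) (n : nat) (f : 'rV[R]_n -> R) (x : 'rV[R]_n) :
    'rV[R]_n :=
  \row_j 'D_(delta_mx 0 j) f x.

Definition locally_lipschitz (R : realType) (n : nat)
    (F : 'rV[R]_n -> 'rV[R]_n) : Prop :=
  forall x : 'rV[R]_n, exists K : R, exists2 U : set 'rV[R]_n, nbhs x U &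
    forall y z, U y -> U z -> enorm (F y - F z) <= K * enorm (y - z).

Definition C11 (R : realType) (n : nat) (f : 'rV[R]_n -> R) : Prop :=
  (forall x, differentiable f x) /\ locally_lipschitz (grad f).

Definition Cset (R : realType) (n r : nat) (psi : 'I_r -> R -> 'rV[R]_n -> R)
    (i : 'I_r) (t : R) : set 'rV[R]_n :=
  [set x | psi i t x <= 0].

Definition active (R : realType) (n r : nat)
    (psi : 'I_r -> R -> 'rV[R]_n -> R) (t : R) (x : 'rV[R]_n) : {set 'I_r} :=
  [set i | psi i t x == 0]%SET.

(* The functions psi i are total in time; only times in [0, T] are constrained.
   The weights lambda are total on 'I_r; only their values on active indices
   matter. *)
Record H3 (R : realType) (T : R) (n r : nat)
    (psi : 'I_r -> R -> 'rV[R]_n -> R) : Prop := {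
  H3_nonempty : forall t : R, 0 <= t <= T ->
    (\bigcap_(i in [set: 'I_r]) Cset psi i t) !=set0;
  H3_continuous : forall i,
    {within `[0, T] `*` [set: 'rV[R]_n],
      continuous (fun p : R * 'rV[R]_n => psi i p.1 p.2)};
  H3_C11 : forall (i : 'I_r) (t : R), 0 <= t <= T -> C11 (psi i t);
  H3_connected : (1 < n)%N ->
    forall (i : 'I_r) (t : R), 0 <= t <= T -> connected (bdry (Cset psi i t));
  H3_convex : n = 1%N ->
    forall (i : 'I_r) (t : R), 0 <= t <= T -> convex_set (Cset psi i t);
  H3_bounds : exists Mt Mpsi rho : R,
    [/\ 0 < Mt, 0 < Mpsi, 0 < rho,
        forall (i : 'I_r) (t : R), 0 <= t <= T -> Cset psi i t `<=` @eball R n rho &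
        forall (i : 'I_r) (t s : R) (x y : 'rV[R]_n), 0 <= t <= T -> 0 <= s <= T ->
          @eball R n (2 * rho) x -> @eball R n (2 * rho) y ->
          `|psi i t x - psi i s x| <= Mt * `|t - s| /\
          enorm (grad (psi i t) x - grad (psi i t) y)
            <= 2 * Mpsi * enorm (x - y)];
  H3_qualification : exists2 eta : R, 0 < eta &
    forall (t : R) (c : 'rV[R]_n) (lambda : 'I_r -> R), 0 <= t <= T ->
      active psi t c != finset.set0 ->
      (forall i, i \in active psi t c -> 0 <= lambda i) ->
      \sum_(i in active psi t c) lambda i = 1 ->
      2 * eta < enorm (\sum_(i in active psi t c) lambda i *: grad (psi i t) c)
}.

(* Derivative at s of a curve relative to a set A of parameters: one-sided at
   the endpoints when A is a segment. *)
Definition quotient_at (R : realType) (n : nat) (G : R -> 'rV[R]_n) (s t : R) :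
    'rV[R]_n :=
  (t - s)^-1 *: (G t - G s).

Definition derivable_within (R : realType) (n : nat) (A : set R)
    (G : R -> 'rV[R]_n) (s : R) : Prop :=
  cvg (quotient_at G s t @[t --> within A s^']).

Definition deriv_within (R : realType) (n : nat) (A : set R)
    (G : R -> 'rV[R]_n) (s : R) : 'rV[R]_n :=
  lim (quotient_at G s t @[t --> within A s^']).

Definition C1_on_01 (R : realType) (n : nat) (G : R -> 'rV[R]_n) : Prop :=
  (forall s : R, 0 <= s <= 1 -> derivable_within `[0, 1] G s) /\
  {within `[0, 1], continuous (deriv_within `[0, 1] G)}.

Definition curve_length (R : realType) (n : nat) (G : R -> 'rV[R]_n) : \bar R :=
  (\int[lebesgue_measure]_(s in `[0%R, 1%R])
     (enorm (deriv_within `[0%R, 1%R] G s))%:E)%E.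

Definition quasiconvex (R : realType) (n : nat) (c : R) (A : set 'rV[R]_n) :
    Prop :=
  forall x y, A x -> A y -> exists G : R -> 'rV[R]_n,
    [/\ C1_on_01 G,
        forall s : R, 0 <= s <= 1 -> A (G s),
        G 0 = x,
        G 1 = y &
        (curve_length G <= (c * enorm (y - x))%:E)%E].

(* Main.v *)
(** The boundary of [{f <= 0}], [f = psi i t], is the zero set of [f], since the
    gradient has norm [> 2 eta] there. Two zeros [x], [y] at distance less than a
    [d] depending only on [eta], [M_psi] and the radius are joined inside the zero
    set by the curve [x + u v + k(u) nu], where [v = y - x], [nu] is the unit
    normal at [x] and [k] is defined implicitly: on this scale the gradient stays
    within half its norm of [grad f x], whatever that norm is, so
    [|k'| <= 3 |v|] with no upper bound on the gradient. For distant [x], [y],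
    connectedness gives a chain of zeros with steps shorter than [d]; visiting
    each cell of a fixed grid at most once bounds the number of steps
    independently of [t]. A smoothstep reparametrisation brings each piece to
    rest at its ends, so that the concatenation is C^1. *)
From HB Require Import structures.
Require Import Defs.
From mathcomp Require Import all_boot all_order all_algebra.
From mathcomp Require Import all_classical all_reals all_analysis.
From mathcomp Require Import zify ring lra.
Set Implicit Arguments.
Unset Strict Implicit.
Unset Printing Implicit Defensive.
Import Order.TTheory GRing.Theory Num.Theory.
Import numFieldNormedType.Exports.
Local Open Scope classical_set_scope.
Local Open Scope ring_scope.

(** * Euclidean inner product and norm, and comparison with the sup norm *)

Definition dot (R : realType) (n : nat) (u v : 'rV[R]_n) : R :=
  \sum_j u 0 j * v 0 j.

Section Euclidean.
Context {R : realType} {n : nat}.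
Implicit Types (u v w : 'rV[R]_n) (a b : R).

Lemma dotC u v : dot u v = dot v u.
Proof. by apply: eq_bigr => j _; rewrite mulrC. Qed.

Lemma dotDr u v w : dot u (v + w) = dot u v + dot u w.
Proof. by rewrite -big_split; apply: eq_bigr => j _; rewrite mxE mulrDr. Qed.

Lemma dotZr a u v : dot u (a *: v) = a * dot u v.
Proof. by rewrite mulr_sumr; apply: eq_bigr => j _; rewrite mxE mulrCA. Qed.

Lemma dotDl u v w : dot (u + v) w = dot u w + dot v w.
Proof. by rewrite !(dotC _ w) dotDr. Qed.

Lemma dotZl a u v : dot (a *: u) v = a * dot u v.
Proof. by rewrite !(dotC _ v) dotZr. Qed.

Lemma dotxx u : dot u u = enorm u ^+ 2.
Proof.
rewrite /enorm sqr_sqrtr; first by apply: eq_bigr => j _; rewrite expr2.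
by apply: sumr_ge0 => j _; exact: sqr_ge0.
Qed.

Lemma enorm_ge0 u : 0 <= enorm u.
Proof. exact: sqrtr_ge0. Qed.

Lemma enorm_eq0 u : enorm u = 0 -> u = 0.
Proof.
move=> u0; apply/rowP => j; rewrite mxE; apply/eqP.
have: \sum_j u 0 j ^+ 2 == 0.
  by rewrite (eq_bigr (fun j => u 0 j * u 0 j)) // -/(dot u u) dotxx u0 expr0n.
rewrite psumr_eq0 => [/allP/(_ j)|k _]; last exact: sqr_ge0.
by rewrite mem_index_enum sqrf_eq0 /=; apply.
Qed.

(** Cauchy-Schwarz: expanding the square of [enorm v *: u - enorm u *: v] gives
    [2 * enorm u * enorm v] times the difference of the two sides. *)
Lemma dot_le u v : dot u v <= enorm u * enorm v.
Proof.
have [u0|u_neq0] := eqVneq (enorm u) 0.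
  rewrite u0 mul0r (enorm_eq0 u0) /dot big1 // => j _; by rewrite mxE mul0r.
have [v0|v_neq0] := eqVneq (enorm v) 0.
  rewrite v0 mulr0 (enorm_eq0 v0) /dot big1 // => j _; by rewrite mxE mulr0.
have u_gt0 : 0 < enorm u by rewrite lt_neqAle eq_sym u_neq0 enorm_ge0.
have v_gt0 : 0 < enorm v by rewrite lt_neqAle eq_sym v_neq0 enorm_ge0.
have : 0 <= dot (enorm v *: u + (- enorm u) *: v) (enorm v *: u + (- enorm u) *: v).
  by rewrite dotxx sqr_ge0.
rewrite dotDr !dotDl !dotZr !dotZl !dotxx (dotC v u).
have uv_gt0 := mulr_gt0 u_gt0 v_gt0.
move=> H; rewrite -(ler_pM2l uv_gt0); nra.
Qed.

Lemma enormZ a u : enorm (a *: u) = `|a| * enorm u.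
Proof.
apply/eqP; rewrite -(@eqrXn2 _ 2) ?enorm_ge0 ?mulr_ge0 ?enorm_ge0 //.
by rewrite -dotxx dotZr dotZl dotxx exprMn real_normK ?num_real // expr2 mulrA.
Qed.

Lemma enorm0 : enorm (0 : 'rV[R]_n) = 0.
Proof. by rewrite -(scale0r 0) enormZ normr0 mul0r. Qed.

Lemma enormN u : enorm (- u) = enorm u.
Proof. by rewrite -scaleN1r enormZ normrN1 mul1r. Qed.

Lemma norm_dot_le u v : `|dot u v| <= enorm u * enorm v.
Proof.
rewrite ler_norml dot_le andbT lerNl -mulN1r -dotZl scaleN1r -(enormN u).
exact: dot_le.
Qed.

Lemma enormD u v : enorm (u + v) <= enorm u + enorm v.
Proof.
rewrite -(@ler_pXn2r _ 2) ?nnegrE ?addr_ge0 ?enorm_ge0 //.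
rewrite -dotxx dotDr !dotDl !dotxx (dotC v u).
by have := dot_le u v; nra.
Qed.

Lemma coord_le_enorm u j : `|u 0 j| <= enorm u.
Proof.
rewrite -(@ler_pXn2r _ 2) ?nnegrE ?enorm_ge0 // -dotxx real_normK ?num_real //.
rewrite /dot (bigD1 j) //= -expr2 lerDl sumr_ge0 // => k _.
by rewrite -expr2 sqr_ge0.
Qed.

Lemma enorm_le_coord u a : (forall j, `|u 0 j| <= a) -> enorm u <= n%:R * a.
Proof.
(* That [a] is nonnegative is read off a coordinate, so dimension 0 is handled apart. *)
case: (posnP n) => [n0|n_gt0] ua.
  have -> : u = 0 by apply/rowP => -[j jn]; exfalso; rewrite n0 in jn.
  rewrite -(scale0r 0) enormZ normr0 mul0r n0 mul0r //.
have a0 : 0 <= a by exact: le_trans (ua (Ordinal n_gt0)).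
rewrite -(@ler_pXn2r _ 2) ?nnegrE ?enorm_ge0 ?mulr_ge0 // -dotxx.
have : dot u u <= \sum_(j < n) a ^+ 2.
  apply: ler_sum => j _; rewrite -expr2 -real_normK ?num_real //.
  by rewrite ler_pXn2r ?nnegrE.
move/le_trans; apply; rewrite sumr_const card_ord exprMn -[leLHS]mulr_natl.
rewrite ler_wpM2r ?sqr_ge0 // -natrX ler_nat expnS expn1 leq_pmulr //.
Qed.

(** Together with [enorm_le_norm], this carries Euclidean estimates over to limits in the library
    topology. *)
Lemma norm_le_enorm u : `|u| <= enorm u.
Proof.
rewrite /Num.Def.normr/= mx_normrE; apply: bigmax_le; first exact: enorm_ge0.
by move=> [i j] _ /=; rewrite (ord1 i) coord_le_enorm.
Qed.

Lemma enorm_le_norm u : enorm u <= n%:R * `|u|.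
Proof.
apply: enorm_le_coord => j; rewrite [leRHS]/Num.Def.normr/= mx_normrE.
exact: (le_bigmax _ (fun ij => `|u ij.1 ij.2|) (0, j)).
Qed.

Lemma cvg_coord {S : Type} {F : set_system S} {FF : Filter F}
    (f : S -> 'rV[R]_n) (l : 'rV[R]_n) j :
  f @ F --> l -> f x 0 j @[x --> F] --> l 0 j.
Proof.
move=> fl; apply: (cvg_comp f (fun M : 'rV[R]_n => M 0 j) fl).
exact: coord_continuous.
Qed.

Lemma cvg_dot {S : Type} {F : set_system S} {FF : Filter F}
    (f g : S -> 'rV[R]_n) u v :
  f @ F --> u -> g @ F --> v -> dot (f x) (g x) @[x --> F] --> dot u v.
Proof.
move=> fu gv; rewrite /dot; apply: (cvg_big add_continuous) => j _.
by apply: cvgM; exact: cvg_coord.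
Qed.

Lemma continuous_enorm : continuous (@enorm R n).
Proof.
move=> u; have -> : @enorm R n = Num.sqrt \o (fun v => dot v v) :> ('rV[R]_n -> R).
  by apply/funext => v /=; rewrite dotxx sqrtr_sqr ger0_norm // enorm_ge0.
apply: continuous_comp; last exact: sqrt_continuous.
exact: (@cvg_dot _ (nbhs u) _ id id u u cvg_id cvg_id).
Qed.

End Euclidean.

(** * Gradients, the mean value theorem and boundaries of sublevel sets *)

Section Differential.
Context {R : realType} {n : nat}.
Variables (f : 'rV[R]_n -> R).
Hypothesis df : forall x, differentiable f x.

Lemma derive_dot x v : 'D_v f x = dot (grad f x) v.
Proof.
rewrite deriveE // [v in LHS]row_sum_delta linear_sum /dot.
by apply: eq_bigr => j _; rewrite linearZ /= mxE deriveE // mulrC.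
Qed.

Lemma is_derive_line (x v : 'rV[R]_n) (a : R) :
  is_derive a 1 (fun b => f (x + b *: v)) (dot (grad f (x + a *: v)) v).
Proof.
rewrite -derive_dot.
have E : (fun h => h^-1 *: (((fun b => f (x + b *: v)) \o shift a) (h *: 1)
      - f (x + a *: v)))
   = (fun h => h^-1 *: ((f \o shift (x + a *: v)) (h *: v) - f (x + a *: v))).
  apply/funext => h /=; congr (_ *: (f _ - _)).
  by rewrite [h *: 1]mulr1 scalerDl addrCA.
have D : derivable f (x + a *: v) v by exact: diff_derivable.
split; first by rewrite /derivable E.
by rewrite /derive E.
Qed.

Lemma mvt_segment (x y : 'rV[R]_n) :
  exists2 a, 0 <= a <= 1 & f y - f x = dot (grad f (x + a *: (y - x))) (y - x).
Proof.
have [a|a|a ain] := @MVT R (fun b => f (x + b *: (y - x)))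
    (fun a => dot (grad f (x + a *: (y - x))) (y - x)) 0 1 ltr01.
- by move=> _; exact: is_derive_line.
- apply/continuous_subspaceT => b.
  have [? _] := is_derive_line x (y - x) b.
  exact/differentiable_continuous/derivable1_diffP.
rewrite subr0 mulr1 scale1r scale0r addr0 (addrC x) subrK => ->.
by exists a => //; move: ain; rewrite in_itv /= => /andP[/ltW -> /ltW ->].
Qed.

Lemma continuous_grad : locally_lipschitz (grad f) -> continuous (grad f).
Proof.
move=> lip x; have [K [U Ux KU]] := lip x.
apply/(@cvgrPdist_lt _ _ _ (nbhs x) _ (grad f)) => e e0.
(* [K] may be zero or negative; this constant is positive, and [n] pays for the change of norm. *)
have K0 : 0 < 1 + `|K| * n%:R by rewrite ltr_pwDl // mulr_ge0.
near=> y.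
apply: (le_lt_trans (norm_le_enorm _)).
apply: (@le_lt_trans _ _ ((1 + `|K| * n%:R) * `|x - y|)); last first.
  rewrite mulrC -ltr_pdivlMr //; near: y.
  exact: (cvgr_dist_lt id x (@cvg_id _ (nbhs x)) _ (divr_gt0 e0 K0)).
apply: (@le_trans _ _ (K * enorm (x - y))).
  by apply: KU; [exact: nbhs_singleton | near: y].
apply: (@le_trans _ _ (`|K| * enorm (x - y))).
  by rewrite ler_wpM2r ?enorm_ge0 // ler_norm.
rewrite mulrDl mul1r -mulrA ler_wpDl //.
by rewrite ler_wpM2l // enorm_le_norm.
Unshelve. all: by end_near. Qed.

(* A zero of [f] interior to the sublevel set would be a local maximum along
   the gradient line. *)
Lemma bdry_sublevel :
  (forall x, f x = 0 -> 0 < enorm (grad f x)) ->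
  bdry [set x | f x <= 0] = [set x | f x = 0].
Proof.
move=> g0; have cf : continuous f by move=> x; exact: differentiable_continuous.
apply/seteqP; split => x /=.
  move=> [cx ix]; have fx : f x <= 0.
    have /closure_id E : closed [set x | f x <= 0].
      exact: (@preimage_closed _ _ f [set z | z <= 0] (fun y _ => cf y) (@closed_le R 0)).
    by move: cx; rewrite -E.
  apply/eqP; rewrite eq_le fx /= leNgt; apply/negP => fx0; apply: ix.
  apply: (filterS (P := [set y | f y < 0])) => [y /ltW //|].
  exact: (@cvgr_lt _ _ (nbhs x) _ f (f x) (cf x) 0 fx0).
move=> fx; split; first by apply: subset_closure; rewrite /= fx.
rewrite /interior /= => /nbhs_ballP [e /= e0 ex].
have gx := g0 _ fx.
set g := grad f x in gx.
have d0 : 0 < e / (enorm g + 1) by rewrite divr_gt0 // addr_gt0.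
have : is_derive (0:R) 1 (fun b => f (x + b *: g)) 0.
  apply: (derive1_at_max (a := - (e / (enorm g + 1))) (b := e / (enorm g + 1))).
  - lra.
  - by move=> b _; have [] := is_derive_line x g b.
  - by rewrite in_itv /= oppr_lt0 d0.
  - move=> b; rewrite in_itv /= -ltr_norml => bd.
    rewrite scale0r addr0 fx; apply: ex.
    rewrite -ball_normE /ball_ /= opprD addrA subrr sub0r normrN normrZ.
    have : `|b| * (enorm g + 1) < e by rewrite -ltr_pdivlMr // addr_gt0.
    by apply: le_lt_trans; rewrite ler_wpM2l // (le_trans (norm_le_enorm _)) // lerDl.
  - have [_ D1] := is_derive_line x g 0.
    move=> [_]; rewrite D1 scale0r addr0 dotxx => /eqP.
    by rewrite sqrf_eq0 gt_eqF.
Qed.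

End Differential.

(** * Paths at rest at both ends: concatenation and length *)

Section SmoothPath.
Context {R : realType} {n : nat}.

(* A globally C^1 path, at rest outside [0, N]: with this normalisation paths
   concatenate by mere addition. *)
Definition rest_path (A : set 'rV[R]_n) (x y : 'rV[R]_n) (N l : R) : Prop :=
  exists G D : R -> 'rV[R]_n,
    [/\ forall (s : R) j, is_derive s 1 (fun u : R => G u 0 j) (D s 0 j),
        continuous D,
        forall s, A (G s) /\ enorm (D s) <= l,
        forall s, s <= 0 -> G s = x /\ D s = 0 &
        forall s, N <= s -> G s = y /\ D s = 0].

Lemma rest_path_le A x y N N' l l' :
  N <= N' -> l <= l' -> rest_path A x y N l -> rest_path A x y N' l'.
Proof.
move=> NN' ll' [G [D [dG cD AG G0 GN]]]; exists G, D; split => //.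
- by move=> s; have [? Dl] := AG s; split => //; exact: le_trans ll'.
- by move=> s N's; apply: GN; exact: le_trans N's.
Qed.

(** Before time [N] the delayed second path still sits at [y], and from [N] on the first one does.
    At every time the sum therefore equals one of the two paths, and so does its derivative. *)
Lemma rest_path_cat A x y z N M l : 0 <= N -> 0 <= M ->
  rest_path A x y N l -> rest_path A y z M l -> rest_path A x z (N + M) l.
Proof.
move=> N0 M0 [G [D [dG cD AG G0 GN]]] [H [E [dH cE AH H0 HM]]].
exists (fun s => G s + (H (s - N) - y)), (fun s => D s + E (s - N)).
have below s : s <= N -> G s + (H (s - N) - y) = G s /\ D s + E (s - N) = D s.
  rewrite -subr_le0 => /H0[-> ->]; by rewrite subrr !addr0.
have above s : N <= s ->
    G s + (H (s - N) - y) = H (s - N) /\ D s + E (s - N) = E (s - N).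
  by move=> /GN[-> ->]; rewrite addrC subrK add0r.
split.
- move=> s j; rewrite mxE.
  have -> : (fun u => (G u + (H (u - N) - y)) 0 j) =
      (fun u => G u 0 j) + (((fun u => H u 0 j) \o shift (- N)) + cst (- y 0 j)).
    by apply/funext => u; rewrite !mxE.
  apply: is_deriveD.
  rewrite -[X in is_derive _ _ _ X]addr0; apply: is_deriveD.
  rewrite -[X in is_derive _ _ _ X]mulr1.
  by apply: is_derive1_comp; exact: is_derive_shift.
- move=> s; apply: cvgD; first exact: cD.
  apply: (@cvg_comp _ _ _ (fun u => u - N) E (nbhs s) (nbhs (s - N))); last exact: cE.
  by apply: cvgB; [exact: cvg_id | exact: cvg_cst].
- by move=> s; have [/below[-> ->]|/ltW/above[-> ->]] := leP s N.
- by move=> s s0; have [-> ->] := below s (le_trans s0 N0); exact: G0.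
- move=> s sNM; have [|-> ->] := above s; first by rewrite (le_trans _ sNM) // lerDl.
  by apply: HM; rewrite lerBrDl.
Qed.

(** Passes from the coordinatewise derivatives of [rest_path] to the vector quotient that defines
    [deriv_within]. *)
Lemma cvg_quotient_at (G : R -> 'rV[R]_n) (D : 'rV[R]_n) (s : R) :
  (forall j, is_derive s 1 (fun u : R => G u 0 j) (D 0 j)) ->
  quotient_at G s t @[t --> s^'] --> D.
Proof.
move=> dG.
have dGs : derivable G s 1.
  by apply/derivable_mxP => i j; rewrite (ord1 i); have [] := dG j.
have GD : 'D_1 G s = D.
  rewrite derive_mx //; apply/rowP => j; rewrite mxE; by have [] := dG j.
have cv : h^-1 *: (G (h + s) - G s) @[h --> 0^'] --> D.
  rewrite -GD /derive; move/cvg_ex : dGs => -[l dl].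
  rewrite /derive (cvg_lim _ dl) //.
  by move: dl; under eq_fun do rewrite /= [_ *: 1]mulr1.
apply/(@cvgrPdist_lt _ _ _ (s^') _ _ _) => e e0.
have /cvgrPdist_lt/(_ e e0) [/= r r0 rP] := cv.
exists r => //= t st ts.
have := rP (t - s); rewrite /= sub0r normrN subrK; apply; first by rewrite distrC.
by rewrite subr_eq0.
Qed.

(** Makes the limit in [deriv_within] unique. Points of the segment close to [s] are found by moving
    towards its farther end. *)
Lemma within_dnbhs01_proper (s : R) :
  0 <= s <= 1 -> ProperFilter (within `[0, 1] s^').
Proof.
move=> /andP[s0 s1]; apply: Build_ProperFilter_ex => P [r /= r0 rP].
have m0 : 0 < Num.min (r / 2) (1 / 2) by rewrite lt_min; apply/andP; split; lra.
have mr : Num.min (r / 2) (1 / 2) <= r / 2 by rewrite ge_min lexx.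
have m1 : Num.min (r / 2) (1 / 2) <= 1 / 2 by rewrite ge_min lexx orbT.
set m := Num.min _ _ in m0 mr m1.
have [sl|sr] := leP s (1 / 2).
- exists (s + m); apply: rP => /=.
  + by rewrite opprD addrA subrr sub0r normrN gtr0_norm //; lra.
  + by rewrite gt_eqF // ltrDl.
  + by rewrite in_itv /=; apply/andP; split; lra.
- exists (s - m); apply: rP => /=.
  + by rewrite opprB addrC subrK gtr0_norm //; lra.
  + by rewrite lt_eqF // ltrBlDr ltrDl.
  + by rewrite in_itv /=; apply/andP; split; lra.
Qed.

(** Running the path [N] times faster fits it into [0, 1] and raises the speed bound to [N * l],
    which then bounds the length. *)
Lemma rest_path_curve A x y N l : 0 < N -> rest_path A x y N l ->
  exists G : R -> 'rV[R]_n,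
    [/\ C1_on_01 G, forall s : R, 0 <= s <= 1 -> A (G s), G 0 = x, G 1 = y &
        (curve_length G <= (N * l)%:E)%E].
Proof.
move=> N0 [G [D [dG cD AG G0 GN]]].
pose H s := G (N * s); pose E s := N *: D (N * s).
have dH (s : R) j : is_derive s 1 (fun u : R => H u 0 j) (E s 0 j).
  rewrite mxE mulrC -[X in _ * X]mulr1.
  have -> : (fun u => H u 0 j) = (fun u => G u 0 j) \o (N *: id) by [].
  by apply: is_derive1_comp; exact: is_deriveZ.
have cE : continuous E.
  move=> s; apply: cvgZr.
  apply: (@cvg_comp _ _ _ (fun u => N * u) D (nbhs s) (nbhs (N * s))); last exact: cD.
  by apply: cvgMr; exact: cvg_id.
have qH s : quotient_at H s t @[t --> s^'] --> E s by exact: cvg_quotient_at.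
have HE s : 0 <= s <= 1 -> deriv_within `[0, 1] H s = E s.
  move=> s01; have FF := within_dnbhs01_proper s01.
  apply: cvg_lim => //; exact: cvg_within_filter.
have HE' : {in `[0, 1]%classic, deriv_within `[0, 1] H =1 E}.
  by move=> s; rewrite inE /= in_itv /= => /HE.
exists H; split.
- split.
    move=> s s01; apply/cvg_ex; exists (E s); exact: cvg_within_filter.
  apply: (@subspace_eq_continuous _ _ _ E).
    by move=> s /HE' ss; rewrite ?ss /= ?ss.
  exact: continuous_subspaceT.
- by move=> s _; have [] := AG (N * s).
- by rewrite /H mulr0; have [] := G0 0 (lexx _).
- by rewrite /H mulr1; have [] := GN N (lexx _).
- rewrite /curve_length.
  have -> : (\int[lebesgue_measure]_(s in `[0%R, 1%R])
        (enorm (deriv_within `[0%R, 1%R] H s))%:E)%E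
      = (\int[lebesgue_measure]_(s in `[0%R, 1%R]) (enorm (E s))%:E)%E.
    by apply: eq_integral => s /HE' ->.
  have -> : (N * l)%:E = (\int[lebesgue_measure]_(s in `[0%R, 1%R])
      (cst (N * l)%:E s))%E :> \bar R.
    by rewrite integral_cst //= lebesgue_measure_itv /= lte_fin ltr01 sube0 mule1.
  apply: ge0_le_integral => //=.
  + by move=> s _; rewrite lee_fin enorm_ge0.
  + apply/measurable_realfun.measurable_EFinP; apply: measurable_funTS.
    apply: measurable_realfun.continuous_measurable_fun => s.
    apply: (@continuous_comp _ _ _ E (@enorm R n)); [exact: cE | exact: continuous_enorm].
  + move=> s _; rewrite lee_fin enormZ gtr0_norm // ler_pM2l //.
    by have [] := AG (N * s).
Qed.

End SmoothPath.

(** * A C^1 time change that is at rest outside [0, 1] *)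

Section Smoothstep.
Context {R : realType}.
Implicit Types s : R.

Definition ramp s : R := Num.max s 0.

(* The quadratic spline with knots 0, 1/2, 1. *)
Definition smoothstep s : R :=
  2 * (ramp s ^+ 2 - 2 * ramp (s - 1/2) ^+ 2 + ramp (s - 1) ^+ 2).

(** The derivative of [smoothstep]: a tent supported in [0, 1] with peak 2 at 1/2. *)
Definition smoothstep' s : R :=
  4 * (ramp s - 2 * ramp (s - 1/2) + ramp (s - 1)).

(** Squaring removes the kink of [ramp]: the first-order remainder is at most the square of the
    increment, whatever the signs of the two points. *)
Lemma is_derive_ramp2 s : is_derive s 1 (fun u => ramp u ^+ 2) (2 * ramp s).
Proof.
have cv : h^-1 *: (ramp (h + s) ^+ 2 - ramp s ^+ 2) @[h --> 0^'] --> 2 * ramp s.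
  apply/cvgrPdist_le => e e0; near=> h.
  have h0 : h != 0 by near: h; exact: nbhs_dnbhs_neq.
  have he : `|h| <= e by near: h; exact: dnbhs0_le.
  rewrite -(ler_pM2l (x := `|h|)) ?normr_gt0 // -normrM.
  apply: (@le_trans _ _ (`|h| * `|h|)); last by rewrite ler_wpM2l.
  have -> : h * (2 * ramp s - h^-1 *: (ramp (h + s) ^+ 2 - ramp s ^+ 2)) =
      h * (2 * ramp s) - (ramp (h + s) ^+ 2 - ramp s ^+ 2).
    by rewrite [_ *: _]/(_ * _) mulrBr mulVKf.
  rewrite -normrM -expr2 [`|h ^+ 2|]ger0_norm ?sqr_ge0 // ler_norml /ramp.
  by case: (leP s 0) => sP; case: (leP (h + s) 0) => hP; apply/andP; split; nra.
have cv' : h^-1 *: (((fun u => ramp u ^+ 2) \o shift s) (h *: 1) - ramp s ^+ 2)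
    @[h --> 0^'] --> 2 * ramp s.
  by under eq_fun do rewrite /= [_ *: 1]mulr1.
split; first by apply/cvg_ex; exists (2 * ramp s).
exact: cvg_lim cv'.
Unshelve. all: by end_near. Qed.

Lemma is_derive_smoothstep s : is_derive s 1 smoothstep (smoothstep' s).
Proof.
have sh k : is_derive s 1 (fun u => ramp (u - k) ^+ 2) (2 * ramp (s - k)).
  rewrite -[2 * _]mulr1.
  apply: (@is_derive1_comp _ (fun u => ramp u ^+ 2) (shift (- k))).
    exact: is_derive_ramp2.
  exact: is_derive_shift.
have -> : smoothstep' s = 2 *: (2 * ramp s - 2 *: (2 * ramp (s - 1/2))
    + 2 * ramp (s - 1)) 
  by have scaleE (a b : R) : a *: b = a * b by []; rewrite /smoothstep' !scaleE; ring.
apply: is_deriveZ; apply: is_deriveD => //.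
by apply: is_deriveB; exact: is_derive_ramp2.
Qed.

Lemma continuous_smoothstep' : continuous smoothstep'.
Proof.
have cr k : continuous (fun u : R => ramp (u - k)).
  move=> u; have -> : (fun u : R => ramp (u - k)) = (fun u => u - k) \max cst 0 by [].
  apply: continuous_max; last exact: cvg_cst.
  by apply: cvgB; [exact: cvg_id | exact: cvg_cst].
move=> s; rewrite /smoothstep'; apply: cvgMr; apply: cvgD; last exact: cr.
apply: cvgB; last by apply: cvgMr; exact: cr.
have E : (fun u => ramp (u - 0)) = ramp by apply/funext => u; rewrite subr0.
by have := cr 0; rewrite E => c0; exact: c0.
Qed.

Lemma smoothstep_itv s : 0 <= smoothstep s <= 1.
Proof.
rewrite /smoothstep /ramp; apply/andP.
by case: (leP s 0) => ?; case: (leP (s - 1/2) 0) => ?;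
   case: (leP (s - 1) 0) => ?; split; nra.
Qed.

Lemma smoothstep'_itv s : 0 <= smoothstep' s <= 2.
Proof.
rewrite /smoothstep' /ramp; apply/andP.
by case: (leP s 0) => ?; case: (leP (s - 1/2) 0) => ?;
   case: (leP (s - 1) 0) => ?; split; lra.
Qed.

Lemma smoothstep_le0 s : s <= 0 -> smoothstep s = 0 /\ smoothstep' s = 0.
Proof.
move=> s0; rewrite /smoothstep /smoothstep' /ramp !max_r; [|lra..].
by split; ring.
Qed.

Lemma smoothstep_ge1 s : 1 <= s -> smoothstep s = 1 /\ smoothstep' s = 0.
Proof.
move=> s0; rewrite /smoothstep /smoothstep' /ramp !max_l; [|lra..].
by split; field.
Qed.

End Smoothstep.

(** * The local path, as the graph of an implicit function over the chord *)

Section LocalPath.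
Context {R : realType} {n : nat}.
Variables (f : 'rV[R]_n -> R) (x y : 'rV[R]_n).
Hypothesis df : forall z, differentiable f z.
Hypothesis cg : continuous (grad f).
Hypotheses (fx0 : f x = 0) (fy0 : f y = 0).
Let v : 'rV[R]_n := y - x.
Let L := enorm (grad f x).
Hypothesis L0 : 0 < L.
(** The radius covers all of [rect]: at most [enorm v] along the chord plus [3 * enorm v] along the
    normal. *)
Hypothesis near_x :
  forall z, enorm (z - x) <= 4 * enorm v -> enorm (grad f z - grad f x) <= L / 2.

Let nu : 'rV[R]_n := L^-1 *: grad f x.
(** The quotient of the two bounds of [grad_bounds], [3 / 2 * L * enorm v] and [L / 2]; it bounds
    both the implicit function and its slope. *)
Let h := 3 * enorm v.
Let pt (u k : R) : 'rV[R]_n := x + (u *: v + k *: nu).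
Let rect (u k : R) := 0 <= u <= 1 /\ `|k| <= h.
(** The slope of k(u), from implicit differentiation of [f (pt u k) = 0]. *)
Let F (p : 'rV[R]_n) := - dot (grad f p) v / dot (grad f p) nu.

Let enorm_nu : enorm nu = 1.
Proof. by rewrite enormZ gtr0_norm ?invr_gt0 // mulVf // gt_eqF. Qed.

Let grad_bounds p : enorm (p - x) <= 4 * enorm v ->
  L / 2 <= dot (grad f p) nu /\ `|dot (grad f p) v| <= 3 / 2 * L * enorm v.
Proof.
move=> /near_x px; have E : grad f p = (grad f p - grad f x) + grad f x by rewrite subrK.
have gnu : dot (grad f x) nu = L.
  by rewrite dotZr dotxx -/L expr2 mulKf // gt_eqF.
split.
  rewrite E dotDl gnu.
  have := norm_dot_le (grad f p - grad f x) nu; rewrite enorm_nu mulr1.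
  by rewrite ler_norml => /andP[H _]; lra.
apply: (le_trans (norm_dot_le _ _)); rewrite ler_wpM2r ?enorm_ge0 // E.
by apply: (le_trans (enormD _ _)); rewrite -/L; lra.
Qed.

Let pt_near u k : rect u k -> enorm (pt u k - x) <= 4 * enorm v.
Proof.
move=> [/andP[u0 u1] kh]; rewrite /pt [x + _]addrC addrK.
apply: (le_trans (enormD _ _)); rewrite (enormZ u) (enormZ k) enorm_nu mulr1 ger0_norm //.
have := ler_piMl (enorm_ge0 v) u1; rewrite /h in kh; lra.
Qed.

Let convex01 (a b c : R) : 0 <= a <= 1 -> 0 <= b <= 1 -> 0 <= c <= 1 ->
  0 <= b + a * (c - b) <= 1.
Proof. by move=> /andP[? ?] /andP[? ?] /andP[? ?]; apply/andP; split; nra. Qed.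

(** The rectangle is convex, so the mean value point stays where [grad_bounds] applies. Its
    closeness to [pt u k] later makes it converge when the increment shrinks. *)
Let mvt_pt u k u' k' : rect u k -> rect u' k' -> exists w,
  [/\ enorm (w - x) <= 4 * enorm v,
      enorm (w - pt u k) <= enorm (pt u' k' - pt u k) &
      f (pt u' k') - f (pt u k) =
        (u' - u) * dot (grad f w) v + (k' - k) * dot (grad f w) nu].
Proof.
move=> uk uk'; have [a a01 E] := mvt_segment df (pt u k) (pt u' k').
have dpt : pt u' k' - pt u k = (u' - u) *: v + (k' - k) *: nu.
  by rewrite /pt opprD addrACA subrr add0r opprD addrACA -!scalerBl.
exists (pt u k + a *: (pt u' k' - pt u k)); split.
- have -> : pt u k + a *: (pt u' k' - pt u k) =
      pt (u + a * (u' - u)) (k + a * (k' - k)).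
    rewrite dpt /pt -addrA; congr (_ + _).
    by rewrite (scalerDr a) !(scalerA a) addrACA -!scalerDl.
  apply: pt_near; case: uk => u01 kh; case: uk' => u01' kh'; split; first exact: convex01.
  move: kh kh'; rewrite !ler_norml => /andP[? ?] /andP[? ?]; case/andP: a01 => ? ?.
  by apply/andP; split; nra.
- rewrite addrC addKr enormZ; case/andP: a01 => a0 a1; rewrite ger0_norm //.
  by rewrite ler_piMl // enorm_ge0.
- by rewrite E dpt dotDr !dotZr.
Qed.

Let pt00 : pt 0 0 = x. Proof. by rewrite /pt !scale0r !addr0. Qed.
Let pt10 : pt 1 0 = y. Proof. by rewrite /pt scale1r scale0r addr0 addrC subrK. Qed.

Let h0 : 0 <= h. Proof. by rewrite mulr_ge0 // enorm_ge0. Qed.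

Let rect0 u : 0 <= u <= 1 -> rect u 0.
Proof. by move=> ?; split=> //; rewrite normr0. Qed.

(** Intermediate values on the normal segment: at [k = h] and [k = - h] the normal term of the mean
    value formula, at least [h * (L / 2)] in size, dominates the chord term and fixes the sign of
    [f]. *)
Let zero_exists u : 0 <= u <= 1 -> exists2 k, `|k| <= h & f (pt u k) = 0.
Proof.
move=> u01; have u01' := u01; case/andP: u01' => u0 u1.
have r00 : rect 0 0 by apply: rect0; rewrite lexx ler01.
have nv := enorm_ge0 v.
have ends e : `|e| = 1 -> 0 <= e * f (pt u (e * h)).
  move=> e1; have r1 : rect u (e * h) by split => //; rewrite normrM e1 mul1r ger0_norm.
  have [w [wx _]] := mvt_pt r00 r1; rewrite pt00 fx0 !subr0 => ->.
  have [gnu gv] := grad_bounds wx.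
  rewrite mulrDr; have -> : e * (e * h * dot (grad f w) nu) = h * dot (grad f w) nu.
    by rewrite !mulrA -expr2 -[e ^+ 2]real_normK ?num_real // e1 expr1n mul1r.
  have A : `|e * (u * dot (grad f w) v)| <= 3 / 2 * L * enorm v.
    rewrite !normrM e1 mul1r (ger0_norm u0); apply: le_trans gv.
    by rewrite ler_piMl.
  have B : h * (L / 2) <= h * dot (grad f w) nu by rewrite ler_wpM2l.
  by move: A B; rewrite ler_norml /h => /andP[A _] B; lra.
have := ends 1 (normr1 _); have := ends (-1) (normrN1 _).
rewrite !mul1r !mulN1r => fN fP.
have [|||k kh fk] := @IVT R (fun k => f (pt u k)) (- h) h 0.
- by rewrite (le_trans _ h0) // oppr_le0.
- apply: continuous_subspaceT => k.
  have -> : (fun k => f (pt u k)) = (fun k => f (x + u *: v + k *: nu)).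
    by apply/funext => b; rewrite /pt addrA.
  have [? _] := is_derive_line df (x + u *: v) nu k.
  exact/differentiable_continuous/derivable1_diffP.
- by rewrite ge_min le_max fP -oppr_ge0 fN orbT.
- by exists k => //; rewrite ler_norml; move: kh; rewrite in_itv.
Qed.

(** Does the work of the implicit function theorem. Solving the mean value formula for [k' - k]
    yields uniqueness when [u = u'], a Lipschitz bound, and the derivative as [w] converges. *)
Let zero_lip u k u' k' : rect u k -> rect u' k' ->
  f (pt u k) = 0 -> f (pt u' k') = 0 -> exists w,
  [/\ enorm (w - pt u k) <= enorm (pt u' k' - pt u k),
     k' - k = (u' - u) * F w & `|F w| <= h].
Proof.
move=> r1 r2 z1 z2; have [w [wx wp]] := mvt_pt r1 r2.
rewrite z1 z2 subrr => /esym /eqP; rewrite addrC addr_eq0 => /eqP E.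
have [gnu gv] := grad_bounds wx.
have gnu0 : 0 < dot (grad f w) nu by apply: lt_le_trans gnu; rewrite divr_gt0.
exists w; split => //.
  by apply: (mulIf (lt0r_neq0 gnu0)); rewrite E /F mulrA divfK ?gt_eqF // mulrN.
rewrite /F normrM normrN normfV (gtr0_norm gnu0) ler_pdivrMr //.
apply: (le_trans gv); rewrite /h.
have := enorm_ge0 v; nra.
Qed.

(** The factor 8 is the peak 2 of [smoothstep'] times 4, from [enorm v] along the chord and at most
    [3 * enorm v] along the normal. *)
Lemma local_path : rest_path [set z | f z = 0] x y 1 (8 * enorm v).
Proof.
(* [tau] is constrained only on [0, 1], where [smoothstep] takes its values. *)
have /choice [tau tauP] : forall u, exists k,
    0 <= u <= 1 -> `|k| <= h /\ f (pt u k) = 0.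
  move=> u; have [u01|nu01] := boolP (0 <= u <= 1); last by exists 0.
  by have [k kh fk] := zero_exists u01; exists k.
have r01 : 0 <= (0 : R) <= 1 by rewrite lexx ler01.
have r11 : 0 <= (1 : R) <= 1 by rewrite lexx ler01.
have rectT u : 0 <= u <= 1 -> rect u (tau u) by move=> u01; have [] := tauP u u01.
have zeroT u : 0 <= u <= 1 -> f (pt u (tau u)) = 0 by move=> u01; have [] := tauP u u01.
(* Uniqueness forces the graph to pass through [x] at [u = 0] and through [y] at [u = 1]. *)
have uniq0 u : 0 <= u <= 1 -> f (pt u 0) = 0 -> tau u = 0.
  move=> u01 fu; have [w [_ + _]] := zero_lip (rect0 u01) (rectT u u01) fu (zeroT u u01).
  by rewrite subrr mul0r subr0.
have tau0 : tau 0 = 0 by apply: uniq0; rewrite ?pt00.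
have tau1 : tau 1 = 0 by apply: uniq0; rewrite ?pt10.
pose sg := @smoothstep R; pose T s := tau (sg s).
pose G s : 'rV[R]_n := pt (sg s) (T s).
pose D s : 'rV[R]_n := smoothstep' s *: (v + F (G s) *: nu).
have sg01 s : 0 <= sg s <= 1 := smoothstep_itv s.
have csg : continuous sg.
  move=> s; have [? _] := is_derive_smoothstep s.
  exact/differentiable_continuous/derivable1_diffP.
have step s t : exists w, [/\ enorm (w - G s) <= enorm (G t - G s),
    T t - T s = (sg t - sg s) * F w & `|F w| <= h].
  by apply: zero_lip; rewrite /G; auto.
have cT : continuous T.
  move=> s; apply/(@cvgrPdist_le _ _ _ (nbhs s) _ T) => e e0.
  have H1 : 0 < h + 1 by rewrite ltr_wpDl.
  near=> t.
  have [w [_ E Fw]] := step t s; rewrite E normrM.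
  apply: (@le_trans _ _ (`|sg s - sg t| * (h + 1))).
    by rewrite ler_wpM2l // (le_trans Fw) // lerDl.
  rewrite -ler_pdivlMr //; near: t.
  exact: (@cvgr_dist_le _ _ _ (nbhs s) _ sg (sg s) (csg s) _ (divr_gt0 e0 H1)).
have cG : continuous G.
  move=> s; apply: cvgD; first exact: cvg_cst.
  by apply: cvgD; apply: cvgZl; [exact: csg | exact: cT].
have gnu0 s : 0 < dot (grad f (G s)) nu.
  have [gnu _] := grad_bounds (pt_near (rectT _ (sg01 s))).
  by apply: lt_le_trans gnu; rewrite divr_gt0.
have cF s : F p @[p --> G s] --> F (G s).
  have cd w : dot (grad f p) w @[p --> G s] --> dot (grad f (G s)) w.
    have c1 : grad f @ nbhs (G s) --> grad f (G s) by exact: cg.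
    have c2 : cst w p @[p --> nbhs (G s)] --> w by exact: cvg_cst.
    exact: (cvg_dot (FF := nbhs_filter (G s)) c1 c2).
  exact: (cvgM (cvgN (cd v)) (cvgV (lt0r_neq0 (gnu0 s)) (cd nu))).
have dT (s : R) : is_derive s 1 T (smoothstep' s * F (G s)).
  (* The difference quotient of [T] is exactly that of [sg] times [F] at an intermediate point
     [w k], which tends to [G s]. *)
  have /choice [w wP] := fun k => step s (k + s).
  have cw : w k @[k --> 0^'] --> G s.
    have cs : k + s @[k --> 0^'] --> s.
      rewrite -[X in _ --> X]add0r; apply: cvgD; last exact: cvg_cst.
      exact: (cvg_trans (cvg_within _) cvg_id).
    have cGs : G (k + s) @[k --> 0^'] --> G s := cvg_comp _ _ cs (cG s).
    apply/(@cvgrPdist_le _ _ _ (0^') _ w) => e e0.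
    have n0 : 0 < n%:R + 1 :> R by rewrite ltr_wpDl.
    near=> k.
    have [wk _ _] := wP k.
    rewrite distrC (le_trans (norm_le_enorm _)) // (le_trans wk) //.
    rewrite (le_trans (enorm_le_norm _)) // distrC.
    apply: (@le_trans _ _ ((n%:R + 1) * `|G s - G (k + s)|)).
      by rewrite ler_wpM2r // lerDl.
    rewrite mulrC -ler_pdivlMr //; near: k.
    exact: (@cvgr_dist_le _ _ _ (0^') _ _ (G s) cGs _ (divr_gt0 e0 n0)).
  have cv : k^-1 *: (T (k + s) - T s) @[k --> 0^'] --> smoothstep' s * F (G s).
    have -> : (fun k => k^-1 *: (T (k + s) - T s)) =
       (fun k => (k^-1 *: (sg (k + s) - sg s)) * F (w k)).
      apply/funext => k; have [_ -> _] := wP k.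
      by rewrite /GRing.scale /= mulrA.
    apply: cvgM; last exact: (cvg_comp _ _ cw (cF s)).
    have [/cvg_ex [l dl] <-] := is_derive_smoothstep s.
    rewrite /derive (cvg_lim _ dl) //.
    by move: dl; under eq_fun do rewrite /= [_ *: 1]mulr1.
  have cv' : k^-1 *: ((T \o shift s) (k *: 1) - T s) @[k --> 0^'] --> smoothstep' s * F (G s).
    by under eq_fun do rewrite /= [_ *: 1]mulr1.
  split; first by apply/cvg_ex; exists (smoothstep' s * F (G s)).
  exact: cvg_lim cv'.
exists G, D; split.
- move=> s j.
  have -> : (fun u => G u 0 j) = cst (x 0 j) + (v 0 j *: sg + nu 0 j *: T).
    by apply/funext => u; rewrite /G /pt !mxE [sg u * _]mulrC [T u * _]mulrC.
  have -> : D s 0 j = 0 + (v 0 j *: smoothstep' s + nu 0 j *: (smoothstep' s * F (G s))).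
    rewrite /D !mxE add0r; have scaleE (a b : R) : a *: b = a * b by [].
    by rewrite !scaleE; ring.
  have dsg : is_derive s 1 sg (smoothstep' s) := is_derive_smoothstep s.
  exact: (is_deriveD (is_derive_cst _ _ _)
    (is_deriveD (is_deriveZ _ dsg) (is_deriveZ _ (dT s)))).
- move=> s; apply: cvgZ; first exact: continuous_smoothstep'.
  apply: cvgD; first exact: cvg_cst.
  apply: cvgZl.
  exact: (@cvg_comp _ _ _ G F (nbhs s) (nbhs (G s)) _ (cG s) (cF s)).
- move=> s; split; first exact: zeroT.
  (* For equal parameters the intermediate point is [G s] itself, which gives the bound on [F]
     there. *)
  have [w [wG _ Fw]] := step s s.
  have {wG} wG : w = G s.
    apply/eqP; rewrite -subr_eq0; apply/eqP/enorm_eq0/eqP.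
    by rewrite eq_le enorm_ge0 andbT (le_trans wG) // subrr enorm0.
  rewrite wG in Fw.
  have /andP[s0 s2] := smoothstep'_itv s.
  rewrite /D enormZ ger0_norm //.
  have : enorm (v + F (G s) *: nu) <= 4 * enorm v.
    apply: (le_trans (enormD _ _)); rewrite (enormZ (F _)) enorm_nu mulr1.
    by move: Fw; rewrite /h; lra.
  have := enorm_ge0 (v + F (G s) *: nu); have := enorm_ge0 v; nra.
- move=> s /smoothstep_le0 [s0 s0']; split.
    by rewrite /G /T /sg s0 tau0 pt00.
  by rewrite /D s0' scale0r.
- move=> s /smoothstep_ge1 [s1 s1']; split.
    by rewrite /G /T /sg s1 tau1 pt10.
  by rewrite /D s1' scale0r.
Unshelve. all: by end_near. Qed.

End LocalPath.

(** * Chains of short steps in a connected set *)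

Section Chains.
Context {R : realType} {n : nat}.

Lemma ball_grid (rho d : R) : 0 < rho -> 0 < d ->
  exists (K : finType) (q : 'rV[R]_n -> K), forall x y,
    enorm x < rho -> enorm y < rho -> q x = q y -> enorm (y - x) < d.
Proof.
move=> rho0 d0; have n0 : 0 < n%:R + 1 :> R by rewrite ltr_wpDl.
(* A cubic cell of side [e] has Euclidean diameter at most [n * e], strictly below [d]. *)
pose e := d / (n%:R + 1); have e0 : 0 < e by rewrite divr_gt0.
pose M := Num.truncn (2 * rho / e).
(* The shift by [rho] makes the coordinates nonnegative on the ball; the indices stay at most [M],
   so [inord] keeps them distinct. *)
pose tr (x : 'rV[R]_n) j := Num.truncn ((x 0 j + rho) / e).
exists {ffun 'I_n -> 'I_M.+1}, (fun x => [ffun j => inord (tr x j)]) => x y xr yr qxy.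
have coord_itv (z : 'rV[R]_n) j : enorm z < rho -> 0 <= (z 0 j + rho) / e <= 2 * rho / e.
  move=> zr; have := le_lt_trans (coord_le_enorm z j) zr.
  rewrite ltr_norml => /andP[z1 z2].
  by rewrite divr_ge0 ?ler_pM2r ?invr_gt0 ?ltW //=; lra.
apply: (@le_lt_trans _ _ (n%:R * e)); last first.
  by rewrite /e mulrA ltr_pdivrMr // mulrC ltr_pM2l // ltrDl.
apply: enorm_le_coord => j.
have /ffunP/(_ j) := qxy; rewrite !ffunE => /(congr1 val) /=.
have /andP[x0 xM] := coord_itv x j xr; have /andP[y0 yM] := coord_itv y j yr.
rewrite !inordK ?ltnS ?le_truncn // => trE.
have := truncn_itv x0; have := truncn_itv y0; rewrite -/(tr x j) -/(tr y j) trE.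
move=> /andP[y1 y2] /andP[x1 x2]; rewrite -natr1 in x2 y2.
have -> : (y - x) 0 j = ((y 0 j + rho) / e - (x 0 j + rho) / e) * e.
  by rewrite !mxE -mulrBl divfK ?gt_eqF //; ring.
rewrite normrM (gtr0_norm e0); apply: ler_piMl; first exact: ltW.
by rewrite ler_norml; apply/andP; split; lra.
Qed.

Lemma open_enorm_ball (p : 'rV[R]_n) (d : R) : open [set z | enorm (z - p) < d].
Proof.
have c : continuous (fun z : 'rV[R]_n => enorm (z - p)).
  move=> z.
  apply: (@continuous_comp 'rV[R]_n 'rV[R]_n R (fun z => z - p) (@enorm R n));
    last exact: continuous_enorm.
  have c1 : w @[w --> nbhs z] --> z by exact: cvg_id.
  have c2 : cst p w @[w --> nbhs z] --> p by exact: cvg_cst.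
  exact: (cvgB c1 c2).
exact: (@open_comp _ _ _ [set a : R | a < d] (fun z _ => c z) (@open_lt _ d)).
Qed.

Lemma connected_chain (A : set 'rV[R]_n) (d l : R) (K : finType) (q : 'rV[R]_n -> K) :
  0 < d -> connected A ->
  (forall x y, A x -> A y -> q x = q y -> enorm (y - x) < d) ->
  (forall x y, A x -> A y -> enorm (y - x) < d -> rest_path A x y 1 l) ->
  forall x y, A x -> A y -> rest_path A x y (#|K| * 2 + 1)%:R l.
Proof.
move=> d0 cA qA pA x y Ax Ay.
(* The graph lives on cells rather than on points, so that a simple path in it has length bounded by
   [#|K|]. *)
pose e := [rel a b : K | `[< exists p p',
  [/\ A p, A p', q p = a, q p' = b & enorm (p' - p) < d] >]].
have eP p p' : A p -> A p' -> enorm (p' - p) < d -> e (q p) (q p').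
  by move=> Ap Ap' pp'; apply/asboolP; exists p, p'.
have enormC (u v : 'rV[R]_n) : enorm (u - v) = enorm (v - u).
  by rewrite -enormN opprB.
have : connect e (q x) (q y).
  (* A step in [A] shorter than [d] neither leaves nor enters [B], which is thus open and closed in
     [A]. *)
  pose B := [set p | A p /\ connect e (q x) (q p)].
  have step p p' : B p -> A p' -> enorm (p' - p) < d -> B p'.
    move=> [Ap xp] Ap' pp'; split=> //; apply: connect_trans xp _.
    by apply: connect1; exact: eP.
  suff BA : B = A by move: Ay; rewrite -BA => -[].
  apply: cA; first by exists x; split.
  - exists (\bigcup_(p in B) [set z | enorm (z - p) < d]).
      by apply: bigcup_open => p _; exact: open_enorm_ball.
    apply/seteqP; split => [z Bz|z [Az [p Bp zp]]].
      split; first by case: Bz.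
      by exists z => //=; rewrite subrr enorm0.
    exact: step zp.
  - exists (~` (\bigcup_(p in A `\` B) [set z | enorm (z - p) < d])).
      by apply: open_closedC; apply: bigcup_open => p _; exact: open_enorm_ball.
    apply/seteqP; split => [z Bz|z [Az zN]].
      split; first by case: Bz.
      move=> [p [Ap nBp] /= zp]; apply: nBp; apply: (step z) => //.
      by rewrite enormC.
    apply: contrapT => nBz; apply: zN; exists z => //=.
    by rewrite subrr enorm0.
move=> /connectP [p0 /shortenP [p ep up _] lastp] {p0}.
have sp : (size p <= #|K|)%N.
  by have := max_card (mem (q x :: p)); rewrite (card_uniqP up) => /ltnW.
(* Each edge costs two pieces: a move inside the current cell to the departure point, then the hop.
   The extra piece is the last move, to [y]. *)
have : rest_path A x y (size p * 2 + 1)%:R l.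
  elim: p x Ax ep lastp {up sp} => [|b p IH] x Ax /=.
    by move=> _ /esym qxy; rewrite mul0n; apply: pA => //; exact: qA.
  move=> /andP[/asboolP [u [u' [Au Au' qu qu' uu']]] pb] lastp.
  rewrite -qu' in pb lastp.
  have -> : ((size p).+1 * 2 + 1)%:R = 1 + (1 + (size p * 2 + 1)%:R) :> R.
    by rewrite -!(natrD _ 1%N); congr _%:R; lia.
  apply: (@rest_path_cat _ _ _ _ u) => //.
    by apply: pA => //; apply: qA.
  by apply: (@rest_path_cat _ _ _ _ u') => //; [exact: pA | exact: IH].
apply: rest_path_le => //; rewrite ler_nat; lia.
Qed.

End Chains.

(** * Quasiconvexity with a constant uniform in time *)

Theorem lemma5p1 (R : realType) (T : R) (n r : nat)
    (psi : 'I_r -> R -> 'rV[R]_n -> R) :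
  0 < T -> (0 < r)%N -> (1 < n)%N -> H3 T psi ->
  forall i : 'I_r, exists2 c : R, 0 < c &
    forall t : R, 0 <= t <= T -> quasiconvex c (bdry (Cset psi i t)).
Proof.
move=> _ _ n1 [_ _ C11psi conn _ bounds [eta eta0 qual]] i.
have [Mt [M [rho [_ M0 rho0 psi_ball psi_lip]]]] := bounds.
(* The division by 4 matches the radius in [near_x]. Within [eta / (2 * M)] the gradient varies by
   at most [eta], less than half its norm at a zero; within [rho] of a zero one stays in the ball of
   radius [2 * rho]. *)
pose d := Num.min (eta / (2 * M)) rho / 4.
have d0 : 0 < d by rewrite divr_gt0 // lt_min rho0 divr_gt0 // mulr_gt0.
have [K [q qd]] := @ball_grid R n rho d rho0 d0.
pose N : R := (#|K| * 2 + 1)%:R.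
have N1 : 1 <= N by rewrite ler1n addn1.
exists (8 * N); first by rewrite mulr_gt0 // (lt_le_trans ltr01).
move=> t tT; pose f := psi i t.
have [df lg] := C11psi i t tT.
have cg : continuous (grad f) := continuous_grad lg.
have g_eta x : f x = 0 -> 2 * eta < enorm (grad f x).
  move=> fx; have ai : i \in active psi t x by rewrite inE; apply/eqP.
  (* All the weight is put on the index [i]. *)
  have := qual t x (fun j => (j == i)%:R) tT.
  rewrite (bigD1 i) //= eqxx big1 ?addr0 => [|j /andP[_ /negPf ->] //].
  rewrite (bigD1 i) //= eqxx big1 ?addr0 ?scale1r; last first.
    by move=> j /andP[_ /negPf ->]; rewrite scale0r.
  apply => //; first by apply/set0Pn; exists i.
have bE : bdry (Cset psi i t) = [set x | f x = 0].
  by apply: bdry_sublevel => // x /g_eta; apply: lt_trans; rewrite mulr_gt0.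
have in_ball x : f x = 0 -> enorm x < rho.
  by move=> fx; apply: (psi_ball i t tT); rewrite /Cset /= -/f fx.
have short x y : f x = 0 -> f y = 0 -> enorm (y - x) < d ->
    rest_path [set z | f z = 0] x y 1 (8 * enorm (y - x)).
  move=> fx fy xy; have L := g_eta x fx.
  apply: local_path => //; first by apply: lt_trans L; rewrite mulr_gt0.
  move=> z zx; have zd : enorm (z - x) < Num.min (eta / (2 * M)) rho.
    by apply: (le_lt_trans zx); move: xy; rewrite /d; lra.
  move: zd; rewrite lt_min => /andP[zM zrho].
  have xrho := in_ball x fx.
  have zb : enorm z < 2 * rho.
    rewrite -(subrK x z); apply: (le_lt_trans (enormD _ _)); lra.
  have xb : enorm x < 2 * rho by lra.
  have [_ lip] := psi_lip i t t z x tT tT zb xb.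
  apply: (le_trans lip).
  have : 2 * M * enorm (z - x) <= eta.
    rewrite mulrC -ler_pdivlMr ?mulr_gt0 //; exact: ltW.
  by move: L; rewrite -/f; lra.
rewrite bE => x y fx fy.
have [xy|xy] := ltP (enorm (y - x)) d.
  have [G [? ? ? ? len]] := rest_path_curve ltr01 (short x y fx fy xy).
  exists G; split => //; apply: (le_trans len); rewrite lee_fin mul1r.
  by rewrite ler_wpM2r ?enorm_ge0 // ler_peMr.
(* At most [N] pieces of length at most [8 * d] each, and here [d <= enorm (y - x)]. *)
have P : rest_path [set z | f z = 0] x y N (8 * d).
  apply: (connected_chain d0 _ _ _ (q := q)) => //.
  - by rewrite -bE; exact: conn.
  - by move=> u v fu fv; apply: qd; exact: in_ball.
  - move=> u v fu fv uv; apply: rest_path_le (short u v fu fv uv) => //.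
    by rewrite ler_pM2l // ltW.
have [G [? ? ? ? len]] := rest_path_curve (lt_le_trans ltr01 N1) P.
exists G; split => //; apply: (le_trans len); rewrite lee_fin mulrCA mulrA.
by rewrite ler_wpM2l // mulr_ge0 // (le_trans ler01).
Qed.
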